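(* Let $K$ be the Killing-Ricci form of a Bol superalgebra $B=B_0\oplus B_1$. Then the following conditions are equivalent: (i) $K([x,y,z],u)=-(-1)^{\bar z(\bar x+\bar y)}K(z,[x,y,u])$ for all $x,y,z,u\in B_0\cup B_1$; (ii) $K([x,y,z],u)=-(-1)^{\bar y(\bar z+\bar u)}K(x,[z,u,y])$ for all $x,y,z,u\in B_0\cup B_1$; (iii) $K(x,[y,z,u])=(-1)^{\bar x\bar y+\bar z\bar u}K(y,[x,u,z])$ for all $x,y,z,u\in B_0\cup B_1$.
   Context: All vector superspaces and superalgebras are finite dimensional over a fixed field $\mathbb{K}$ of characteristic $0$; $\bar x\in\mathbb{Z}_2$ denotes the parity of a homogeneous element $x$. A Bol superalgebra is a superspace $B=B_0\oplus B_1$ with a bilinear operation $(x,y)\mapsto x\cdot y=xy$, $B_i\cdot B_j\subseteq B_{i+j}$, and a trilinear operation $[\,,\,,\,]$, $[B_i,B_j,B_k]\subseteq B_{i+j+k}$, such that for all homogeneous $x,y,z,u,v,w$: (BS1) $x\cdot y=-(-1)^{\bar x\bar y}y\cdot x$; (BS2) $[x,y,z]=-(-1)^{\bar x\bar y}[y,x,z]$; (BS3) $[x,y,z]+(-1)^{\bar x(\bar y+\bar z)}[y,z,x]+(-1)^{\bar z(\bar x+\bar y)}[z,x,y]=0$; (BS4) $[x,y,[u,v,w]]=[[x,y,u],v,w]+(-1)^{\bar u(\bar x+\bar y)}[u,[x,y,v],w]+(-1)^{(\bar x+\bar y)(\bar u+\bar v)}[u,v,[x,y,w]]$; (BS5)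 $[x,y,u\cdot v]=(-1)^{\bar u(\bar x+\bar y)}u\cdot[x,y,v]+[x,y,u]\cdot v+(-1)^{(\bar x+\bar y)(\bar u+\bar v)}[u,v,x\cdot y]+(x\cdot y)\cdot(u\cdot v)$. A linear map $P:B\to B$ of degree $r\in\mathbb{Z}_2$ is a pseudo superderivation with companion $a\in B_r$ if for all homogeneous $x,y,z$: $P([x,y,z])=[P(x),y,z]+(-1)^{r\bar x}[x,P(y),z]+(-1)^{r(\bar x+\bar y)}[x,y,P(z)]$ and $P(xy)=(-1)^{r\bar x}xP(y)+P(x)y+(-1)^{r(\bar x+\bar y)}[x,y,a]+a\cdot xy$. $\mathrm{Com}(P)$ is the set of companions of $P$. For homogeneous $x,y$, $D_{x,y}(z)=[x,y,z]$ is a pseudo superderivation of degree $\bar x+\bar y$ with companion $xy$. Let $ipS_r(B,B)$ be the span of all $D_{x,y}$ with $x,y$ homogeneous, $\bar x+\bar y=r$; let $IPS_r(B,B)=\{(P,c):P\in ipS_r(B,B),\ c\in\mathrm{Com}(P)\}$ and $IPS(B,B)=IPS_0(B,B)\oplus IPS_1(B,B)$. The standard enveloping Lie superalgebra of $B$ is $L(B)=B\oplus IPS(B,B)$, graded by $L(B)_i=B_i\oplus IPS_i(B,B)$, with bracket (bilinear), for homogeneous $x,y\in B$ and $(P,a)\in IPS_r(B,B)$, $(Q,b)\in IPS_s(B,B)$: $[x,y]=(D_{x,y},xy)$; $[(P,a),x]=-(-1)^{r\bar x}[x,(P,a)]=P(x)$; $[(P,a),(Q,b)]=(PQ-(-1)^{rs}QP,\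 P(b)-(-1)^{rs}Q(a)-ab)$. It is a Lie superalgebra. Its Killing form is $\alpha(u,v)=\mathrm{str}(\mathrm{ad}\,u\circ\mathrm{ad}\,v)$ ($\mathrm{str}$ = supertrace). The Killing-Ricci form of $B$ is the restriction of $\alpha$ to $B\times B$. *)

(* Defs.v *)
From HB Require Import structures.
From mathcomp Require Import all_boot all_order all_algebra.
From mathcomp Require Import boolp.
Set Implicit Arguments.
Unset Strict Implicit.
Unset Printing Implicit Defensive.
Import GRing.Theory.
Local Open Scope ring_scope.

(* Z_2 is represented by bool: false is 0, true is 1, the sum i + j is i (+) j
   and the product i j, in the exponents of signs, is i && j. *)

Lemma spanning_seq_exists (F : fieldType) (W : vectType F) (S : W -> Prop) :
  exists X : seq W, (forall v, v \in X -> S v) /\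
                    (forall v, S v -> v \in <<X>>%VS).
Proof.
suff H n (X : seq W) : (\dim {:W} - \dim <<X>>%VS <= n)%N ->
    (forall v, v \in X -> S v) ->
    exists X' : seq W, (forall v, v \in X' -> S v) /\
                       (forall v, S v -> v \in <<X'>>%VS).
  by apply: (H _ [::] (leqnn _)).
elim: n X => [|n IHn] X leXn XS.
  exists X; split=> // v _.
  suff -> : <<X>>%VS = fullv by rewrite memvf.
  by apply/eqP; rewrite eqEdim subvf -subn_eq0 -leqn0.
have [XP | /existsNP[v /not_implyP[Sv /negP vX]]] :=
  pselect (forall v, S v -> v \in <<X>>%VS); first by exists X.
apply: (IHn (v :: X)) => [|w]; last first.
  by rewrite inE => /predU1P[-> // | /XS].
have ltXv : (\dim <<X>>%VS < \dim <<v :: X>>%VS)%N.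
  rewrite ltn_neqAle dimvS ?span_cons ?addvSr // andbT.
  apply: contra vX => /eqP eqd.
  have /eqP -> : (<<X>> == <<v :: X>>)%VS.
    by rewrite eqEdim span_cons addvSr eqd leqnn.
  by rewrite memv_span // mem_head.
rewrite leq_subLR; apply: leq_trans (_ : \dim <<X>>%VS + n.+1 <= _)%N.
  by rewrite -leq_subLR.
by rewrite addnS -addSn leq_add2r.
Qed.

Definition spanset (F : fieldType) (W : vectType F) (S : W -> Prop) :
    {vspace W} :=
  <<projT1 (cid (spanning_seq_exists S))>>%VS.

Lemma spanset_subP (F : fieldType) (W : vectType F) (S : W -> Prop)
    (U : {vspace W}) :
  (forall v, S v -> v \in U) <-> (spanset S <= U)%VS.
Proof.
rewrite /spanset; case: cid => X [XS SX] /=; split=> [SU | XU v /SX].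
  by apply/span_subvP=> v /XS/SU.
exact: (subvP XU).
Qed.

Lemma mem_spanset (F : fieldType) (W : vectType F) (S : W -> Prop) (v : W) :
  S v -> v \in spanset S.
Proof. by move: v; apply/spanset_subP. Qed.

Lemma spanset_id (F : fieldType) (W : vectType F) (S : W -> Prop) :
    S 0 -> (forall a u v, S u -> S v -> S (a *: u + v)) ->
  forall v, v \in spanset S <-> S v.
Proof.
move=> S0 Slin v; split; last exact: mem_spanset.
rewrite /spanset; case: cid => X [XS SX] /= vX.
rewrite (coord_span (X := in_tuple X) vX); elim/big_ind: _ => // [x y Sx Sy | i _].
  by rewrite -[x]scale1r; apply: Slin.
by rewrite -[X in S X]addr0; apply: Slin => //; apply/XS/mem_nth.
Qed.

(* The supertrace of an endomorphism that preserves G_0 + G_1: the trace of its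
   diagonal block on G_0 minus the trace of its diagonal block on G_1.  Here W
   may be larger than the superspace G_0 + G_1. *)
Definition block_trace (F : fieldType) (W : vectType F) (U U' : {vspace W})
    (f : 'End(W)) : F :=
  \sum_(i < \dim U)
    coord (vbasis U) i (daddv_pi U U' (f (tnth (vbasis U) i))).

Definition supertrace (F : fieldType) (W : vectType F)
    (G : bool -> {vspace W}) (f : 'End(W)) : F :=
  block_trace (G false) (G true) f - block_trace (G true) (G false) f.

Record bolSuperalgebra (F : fieldType) (V : vectType F) := BolSuperalgebra {
  bgrade :> bool -> {vspace V};
  bmul : 'Hom(V, 'End(V));
  btri : 'Hom(V, 'Hom(V, 'End(V)));
  bgrade_add : (bgrade false + bgrade true)%VS = fullv;
  bgrade_cap : (bgrade false :&: bgrade true)%VS = 0%VS;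
  bmul_grade : forall i j x y, x \in bgrade i -> y \in bgrade j ->
    bmul x y \in bgrade (i (+) j);
  btri_grade : forall i j k x y z,
    x \in bgrade i -> y \in bgrade j -> z \in bgrade k ->
    btri x y z \in bgrade (i (+) j (+) k);
  bol1 : forall i j x y, x \in bgrade i -> y \in bgrade j ->
    bmul x y = - ((-1) ^+ (i && j) *: bmul y x);
  bol2 : forall i j k x y z,
    x \in bgrade i -> y \in bgrade j -> z \in bgrade k ->
    btri x y z = - ((-1) ^+ (i && j) *: btri y x z);
  bol3 : forall i j k x y z,
    x \in bgrade i -> y \in bgrade j -> z \in bgrade k ->
    btri x y z + (-1) ^+ (i && (j (+) k)) *: btri y z x
      + (-1) ^+ (k && (i (+) j)) *: btri z x y = 0;
  bol4 : forall i j k l m x y u v w,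
    x \in bgrade i -> y \in bgrade j ->
    u \in bgrade k -> v \in bgrade l -> w \in bgrade m ->
    btri x y (btri u v w) =
      btri (btri x y u) v w
      + (-1) ^+ (k && (i (+) j)) *: btri u (btri x y v) w
      + (-1) ^+ ((i (+) j) && (k (+) l)) *: btri u v (btri x y w);
  bol5 : forall i j k l x y u v,
    x \in bgrade i -> y \in bgrade j -> u \in bgrade k -> v \in bgrade l ->
    btri x y (bmul u v) =
      (-1) ^+ (k && (i (+) j)) *: bmul u (btri x y v)
      + bmul (btri x y u) v
      + (-1) ^+ ((i (+) j) && (k (+) l)) *: btri u v (bmul x y)
      + bmul (bmul x y) (bmul u v)
}.

(* D_{x,y} is the endomorphism btri B x y. *)

(* P is a pseudo superderivation of degree r with companion a,
   i.e. a belongs to Com(P). *)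
Definition companion (F : fieldType) (V : vectType F) (B : bolSuperalgebra V)
    (r : bool) (P : 'End(V)) (a : V) : Prop :=
  [/\ forall i x, x \in B i -> P x \in B (r (+) i),
      a \in B r,
      forall i j k x y z, x \in B i -> y \in B j -> z \in B k ->
        P (btri B x y z) =
          btri B (P x) y z
          + (-1) ^+ (r && i) *: btri B x (P y) z
          + (-1) ^+ (r && (i (+) j)) *: btri B x y (P z)
    & forall i j x y, x \in B i -> y \in B j ->
        P (bmul B x y) =
          (-1) ^+ (r && i) *: bmul B x (P y)
          + bmul B (P x) y
          + (-1) ^+ (r && (i (+) j)) *: btri B x y a
          + bmul B a (bmul B x y)].

Definition ipS (F : fieldType) (V : vectType F) (B : bolSuperalgebra V)
    (r : bool) : {vspace 'End(V)} :=
  spanset (fun D : 'End(V) => exists i j x y,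
    [/\ x \in B i, y \in B j, i (+) j = r & D = btri B x y]).

(* The set being spanned is already a subspace, see mem_IPS. *)
Definition IPS (F : fieldType) (V : vectType F) (B : bolSuperalgebra V)
    (r : bool) : {vspace 'End(V) * V} :=
  spanset (fun p : 'End(V) * V => p.1 \in ipS B r /\ companion B r p.1 p.2).

Lemma mem_IPS (F : fieldType) (V : vectType F) (B : bolSuperalgebra V)
    (r : bool) (P : 'End(V)) (c : V) :
  (P, c) \in IPS B r <-> P \in ipS B r /\ companion B r P c.
Proof.
rewrite /IPS spanset_id //=.
  split; [exact: mem0v | split].
  - by move=> i x _; rewrite zero_lfunE mem0v.
  - exact: mem0v.
  - move=> i j k x y z _ _ _.
    by rewrite !(zero_lfunE, linear0, addr0).
  - move=> i j x y _ _.
    by rewrite !(zero_lfunE, linear0, addr0).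
move=> t [P1 a1] [P2 a2] /= [I1 [g1 h1 T1 M1]] [I2 [g2 h2 T2 M2]].
split; first by rewrite memvD ?memvZ.
split.
- move=> i x xi; rewrite add_lfunE scale_lfunE.
  by apply: memvD (g2 _ _ xi); apply/memvZ/g1.
- by rewrite memvD ?memvZ.
- move=> i j k x y z xi yj zk.
  rewrite !lfun_simp (T1 i j k) // (T2 i j k) //.
  rewrite !(linearP, lfun_simp) !scalerDr.
  by rewrite addrACA; congr (_ + _); rewrite addrACA.
- move=> i j x y xi yj.
  rewrite !lfun_simp (M1 i j) // (M2 i j) //.
  rewrite !(linearP, lfun_simp) !scalerDr.
  rewrite addrACA; congr (_ + _).
  by rewrite addrACA; congr (_ + _); rewrite addrACA.
Qed.

(* L(B) = B + IPS(B,B) is the subspace L(B)_0 + L(B)_1 of V * ('End(V) * V);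
   the triple (x, (P, a)) stands for x + (P, a). *)
Definition lieT (F : fieldType) (V : vectType F) : vectType F :=
  (V * ('End(V) * V))%type.

Definition Lgrade (F : fieldType) (V : vectType F) (B : bolSuperalgebra V)
    (i : bool) : {vspace lieT V} :=
  (linfun (fst : lieT V -> V) @^-1: B i
   :&: linfun (snd : lieT V -> 'End(V) * V) @^-1: IPS B i)%VS.

Lemma mem_Lgrade (F : fieldType) (V : vectType F) (B : bolSuperalgebra V)
    (i : bool) (u : lieT V) :
  (u \in Lgrade B i) = (u.1 \in B i) && (u.2 \in IPS B i).
Proof. by rewrite memv_cap -!memv_preim !lfunE. Qed.

Lemma bgrade_capv (F : fieldType) (V : vectType F) (B : bolSuperalgebra V)
    (i : bool) : (B i :&: B (~~ i) = 0)%VS.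
Proof. by case: i; rewrite /= ?[(B true :&: _)%VS]capvC bgrade_cap. Qed.

Lemma bgrade_eq0 (F : fieldType) (V : vectType F) (B : bolSuperalgebra V)
    (i : bool) (x : V) : x \in B i -> x \in B (~~ i) -> x = 0.
Proof.
by move=> xi xj; apply/eqP; rewrite -memv0 -(bgrade_capv B i) memv_cap xi xj.
Qed.

Lemma Lgrade_cap (F : fieldType) (V : vectType F) (B : bolSuperalgebra V)
    (i : bool) : (Lgrade B i :&: Lgrade B (~~ i) = 0)%VS.
Proof.
apply/eqP; rewrite -subv0; apply/subvP=> -[x [P a]].
rewrite memv_cap !mem_Lgrade /=.
case/andP=> /andP[xi /mem_IPS[_ [Pi ai _ _]]] /andP[xj /mem_IPS[_ [Pj aj _ _]]].
rewrite (bgrade_eq0 xi xj) (bgrade_eq0 ai aj).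
suff -> : P = 0 by rewrite mem0v.
have P0 k y : y \in B k -> P y = 0.
  by move=> yk; apply: (bgrade_eq0 (Pi _ _ yk)); rewrite -addNb; apply: Pj.
apply/lfunP=> y; have := memvf y; rewrite -(bgrade_add B).
case/memv_addP=> y0 y0B [y1 y1B ->].
by rewrite linearD /= (P0 _ _ y0B) (P0 _ _ y1B) addr0 zero_lfunE.
Qed.

Definition Lcomp (F : fieldType) (V : vectType F) (B : bolSuperalgebra V)
    (i : bool) (u : lieT V) : lieT V :=
  daddv_pi (Lgrade B i) (Lgrade B (~~ i)) u.

(* The bracket of u = x + (P, a) in L(B)_i and v = y + (Q, b) in L(B)_j:
   [x, y] + [x, (Q, b)] + [(P, a), y] + [(P, a), (Q, b)]. *)
Definition homLbracket (F : fieldType) (V : vectType F) (B : bolSuperalgebra V)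
    (i j : bool) (u v : lieT V) : lieT V :=
  let: (x, (P, a)) := u in
  let: (y, (Q, b)) := v in
  (P y - (-1) ^+ (i && j) *: Q x,
   (btri B x y + ((P \o Q)%VF - (-1) ^+ (i && j) *: (Q \o P)%VF),
    bmul B x y + (P b - (-1) ^+ (i && j) *: Q a - bmul B a b))).

Definition Lbracket (F : fieldType) (V : vectType F) (B : bolSuperalgebra V)
    (u v : lieT V) : lieT V :=
  \sum_(i : bool) \sum_(j : bool) homLbracket B i j (Lcomp B i u) (Lcomp B j v).

Lemma Lcomp_hom (F : fieldType) (V : vectType F) (B : bolSuperalgebra V)
    (i k : bool) (u : lieT V) :
  u \in Lgrade B i -> Lcomp B k u = if k == i then u else 0.
Proof.
move=> ui; have dk := Lgrade_cap B k; rewrite /Lcomp; case: eqP => [-> | nki].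
  by rewrite daddv_pi_id // Lgrade_cap.
have uk : u \in Lgrade B (~~ k) by case: k i nki ui {dk} => [] [].
have /(congr1 (fun w => w - u)) : daddv_pi (Lgrade B k) (Lgrade B (~~ k)) u
    + daddv_pi (Lgrade B (~~ k)) (Lgrade B k) u = u.
  by rewrite daddv_pi_add //; apply: (subvP (addvSr _ _)).
by rewrite [X in _ + X - _]daddv_pi_id ?addrK ?subrr // capvC.
Qed.

Lemma homLbracket0l (F : fieldType) (V : vectType F) (B : bolSuperalgebra V)
    (i j : bool) (v : lieT V) : homLbracket B i j 0 v = 0.
Proof.
case: v => y [Q b] /=; rewrite !linear0 comp_lfun0r comp_lfun0l.
by rewrite !(zero_lfunE, linear0, subr0, addr0).
Qed.

Lemma homLbracket0r (F : fieldType) (V : vectType F) (B : bolSuperalgebra V)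
    (i j : bool) (u : lieT V) : homLbracket B i j u 0 = 0.
Proof.
case: u => x [P a] /=; rewrite !linear0 comp_lfun0r comp_lfun0l.
by rewrite !(zero_lfunE, linear0, subr0, addr0).
Qed.

Lemma Lbracket_hom (F : fieldType) (V : vectType F) (B : bolSuperalgebra V)
    (i j : bool) (u v : lieT V) :
  u \in Lgrade B i -> v \in Lgrade B j -> Lbracket B u v = homLbracket B i j u v.
Proof.
move=> ui vj; rewrite /Lbracket (bigD1 i) //= (bigD1 j) //=.
rewrite (Lcomp_hom _ ui) (Lcomp_hom _ vj) !eqxx.
rewrite big1 => [|l nlj]; last by rewrite (Lcomp_hom _ vj) (negPf nlj) homLbracket0r.
rewrite big1 ?addr0 // => k nki; rewrite big1 // => l _.
by rewrite (Lcomp_hom _ ui) (negPf nki) homLbracket0l.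
Qed.

Definition Lad (F : fieldType) (V : vectType F) (B : bolSuperalgebra V)
    (u : lieT V) : 'End(lieT V) := linfun (Lbracket B u).

Lemma LadE (F : fieldType) (V : vectType F) (B : bolSuperalgebra V)
    (u v : lieT V) : Lad B u v = Lbracket B u v.
Proof.
have hl i j w : linear (homLbracket B i j w).
  case: w => x [P a] t [y1 [Q1 b1]] [y2 [Q2 b2]] /=.
  congr (_, (_, _)).
  - by rewrite !(linearP, lfun_simp) /= !scalerDr addrACA.
  - apply/lfunP=> z; rewrite !(linearP, lfun_simp) /= !scalerDr.
    by rewrite [RHS]addrACA; congr (_ + _); rewrite addrACA.
  - rewrite !(linearP, lfun_simp) /= !scalerDr [RHS]addrACA; congr (_ + _).
    by rewrite [RHS]addrACA; congr (_ + _); rewrite addrACA.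
have bl : linear (Lbracket B u).
  move=> t v1 v2; rewrite /Lbracket scaler_sumr -big_split /=.
  apply: eq_bigr => i _; rewrite scaler_sumr -big_split /=.
  by apply: eq_bigr => j _; rewrite /Lcomp linearP hl.
pose mix := GRing.isLinear.Build _ _ _ _ (Lbracket B u) bl.
pose lB : {linear lieT V -> lieT V} := HB.pack (Lbracket B u) mix.
exact: (lfunE lB).
Qed.

Definition killing (F : fieldType) (V : vectType F) (B : bolSuperalgebra V)
    (u v : lieT V) : F :=
  supertrace (Lgrade B) (Lad B u \o Lad B v)%VF.

Definition killing_ricci (F : fieldType) (V : vectType F)
    (B : bolSuperalgebra V) (x y : V) : F :=
  killing B (x, 0) (y, 0).

(* Main.v *)
Require Import Defs.
From mathcomp Require Import all_boot all_order all_algebra.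
From mathcomp Require Import ring.
Set Implicit Arguments.
Unset Strict Implicit.
Unset Printing Implicit Defensive.
Import GRing.Theory.
Local Open Scope ring_scope.

(** The Killing-Ricci form K is bilinear and supersymmetric, and the statement
    holds for every such form.  Put T(x,y,z,u) = K([x,y,z],u).  By
    supersymmetry each of the three conditions is a symmetry of T, where the
    sign (-1)^(ij) is paid whenever arguments of degrees i and j are exchanged:
    (i) says that T is skew in its last two arguments ([skew_lastP]), while
    (ii), in view of (BS2), and (iii) both say that T is invariant under the
    reversal of its four arguments ([reversible_leftP], [reversible_rightP]).

    Reversing, exchanging the first two arguments and reversing again exchanges
    the last two, so (ii) and (BS2) imply (i).  Conversely (i), (BS2) and the
    cyclic identity (BS3) are the symmetries of a curvature tensor.  As for
    those, a combination of four cyclic identities gives the invariance of T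
    under the exchange of the pairs (x,y) and (z,u), up to a factor 2, which is
    invertible in characteristic 0.  Together with the two skew-symmetries this
    is the invariance under reversal ([curvature_skew_rev]).

    Supersymmetry of K ([killing_ricci_supersym]) holds because the supertrace
    vanishes on supercommutators ([supertrace_supercomm]), in particular on that
    of ad x and ad y for x, y in B: these operators preserve the grading of
    L(B) up to a shift, since D_{x,y} is a pseudo superderivation with companion
    xy ([companion_btri]). *)

(** * Supertraces of products *)

(** If g maps U1 to U2 and f maps U2 to U1, then f g and g f have the same
    trace on U1 and U2 respectively. *)
Lemma trace_comp_comm (F : fieldType) (W : vectType F) (U1 U2 : {vspace W})
    (f g : 'End(W)) :
    (forall w, w \in U1 -> g w \in U2) -> (forall w, w \in U2 -> f w \in U1) ->
  \sum_(i < \dim U1) coord (vbasis U1) i (f (g (tnth (vbasis U1) i)))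
  = \sum_(j < \dim U2) coord (vbasis U2) j (g (f (tnth (vbasis U2) j))).
Proof.
have expand (V1 V2 : {vspace W}) (p q : 'End(W)) i :
    (forall w, w \in V1 -> q w \in V2) ->
  coord (vbasis V1) i (p (q (tnth (vbasis V1) i)))
  = \sum_(j < \dim V2) coord (vbasis V2) j (q (tnth (vbasis V1) i))
                        * coord (vbasis V1) i (p (tnth (vbasis V2) j)).
  move=> q12; have := q12 _ (vbasis_mem (mem_tnth i (vbasis V1))).
  set w := q _ => wV2; rewrite [in LHS](coord_vbasis wV2) !linear_sum /=.
  by apply: eq_bigr => j _; rewrite !linearZ /= -tnth_nth.
move=> g12 f21; under eq_bigr do rewrite (expand _ U2) //.
under [RHS]eq_bigr do rewrite (expand _ U1) //.
rewrite exchange_big; apply: eq_bigr => j _.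
by apply: eq_bigr => i _; rewrite mulrC.
Qed.

Lemma daddv_pi_eq0 (F : fieldType) (W : vectType F) (U U' : {vspace W}) (w : W) :
  (U :&: U' = 0)%VS -> w \in U' -> daddv_pi U U' w = 0.
Proof.
move=> dU wU'; have := daddv_pi_add dU (subvP (addvSr _ _) _ wU').
rewrite [X in _ + X]daddv_pi_id ?(capvC U') //.
by move=> /(congr1 (fun v => v - w)); rewrite addrK subrr.
Qed.

(** The supertrace vanishes on the supercommutator of homogeneous
    endomorphisms of degrees r and s. *)
Lemma supertrace_supercomm (F : fieldType) (W : vectType F)
    (G : bool -> {vspace W}) (r s : bool) (f g : 'End(W)) :
    (forall k, (G k :&: G (~~ k) = 0)%VS) ->
    (forall k w, w \in G k -> f w \in G (r (+) k)) ->
    (forall k w, w \in G k -> g w \in G (s (+) k)) ->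
  supertrace G (f \o g)%VF = (-1) ^+ (r && s) * supertrace G (g \o f)%VF.
Proof.
move=> dG fG gG; have [ers | ners] := eqVneq r s; last first.
  (* A product of odd degree has no diagonal block. *)
  have block0 k (h : 'End(W)) : (forall w, w \in G k -> h w \in G (~~ k)) ->
      block_trace (G k) (G (~~ k)) h = 0.
    move=> hG; apply: big1 => i _.
    by rewrite daddv_pi_eq0 ?hG ?vbasis_mem ?mem_tnth ?linear0.
  suff H0 (p q : 'End(W)) : (forall k w, w \in G k -> (p \o q)%VF w \in G (~~ k)) ->
      supertrace G (p \o q)%VF = 0.
    rewrite !H0 ?mulr0 // => k w wk; rewrite comp_lfunE.
      by have := gG _ _ (fG _ _ wk); case: r s k ners {fG gG wk} => [] [] [].
    by have := fG _ _ (gG _ _ wk); case: r s k ners {fG gG wk} => [] [] [].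
  move=> pqG; rewrite /supertrace.
  by rewrite (block0 false _ (pqG false)) (block0 true _ (pqG true)) subrr.
rewrite -{s}ers in gG *; rewrite andbb.
have blockE k (p q : 'End(W)) :
    (forall l w, w \in G l -> p w \in G (r (+) l)) ->
    (forall l w, w \in G l -> q w \in G (r (+) l)) ->
  block_trace (G k) (G (~~ k)) (p \o q)%VF
  = block_trace (G (r (+) k)) (G (~~ (r (+) k))) (q \o p)%VF.
  have projE l (u v : 'End(W)) :
      (forall l w, w \in G l -> u w \in G (r (+) l)) ->
      (forall l w, w \in G l -> v w \in G (r (+) l)) ->
    block_trace (G l) (G (~~ l)) (u \o v)%VF
    = \sum_(i < \dim (G l))
        coord (vbasis (G l)) i (u (v (tnth (vbasis (G l)) i))).
    move=> uG vG; apply: eq_bigr => i _; rewrite comp_lfunE daddv_pi_id //.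
    by rewrite -[X in _ \in G X](addKb r) uG ?vG ?vbasis_mem ?mem_tnth.
  move=> pG qG; rewrite !projE //; apply: trace_comp_comm; first exact: qG.
  by move=> w /pG; rewrite addKb.
rewrite /supertrace (blockE false f g) // (blockE true f g) // {blockE}.
by case: r {fG gG} => /=; rewrite ?expr1 ?expr0 ?mul1r ?mulN1r ?opprB.
Qed.

(** * The Killing-Ricci form *)

Lemma companion_btri (F : fieldType) (V : vectType F) (B : bolSuperalgebra V)
    (i j : bool) (x y : V) :
  x \in B i -> y \in B j -> companion B (i (+) j) (btri B x y) (bmul B x y).
Proof.
move=> xi yj; split; first 2 last.
- move=> k l m u v w uk vl wm; rewrite (bol4 xi yj uk vl wm).
  by rewrite (andbC (i (+) j) k).
- move=> k l u v uk vl; rewrite (bol5 xi yj uk vl).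
  by rewrite (andbC (i (+) j) k).
- by move=> k z zk; apply: btri_grade.
- exact: bmul_grade.
Qed.

(** The operator ad x on L(B) is homogeneous of the degree of x. *)
Lemma Lad_grade (F : fieldType) (V : vectType F) (B : bolSuperalgebra V)
    (i k : bool) (x : V) (w : lieT V) :
  x \in B i -> w \in Lgrade B k -> Lad B (x, 0) w \in Lgrade B (i (+) k).
Proof.
move=> xi wk; have x0 : (x, 0) \in Lgrade B i by rewrite mem_Lgrade xi mem0v.
rewrite LadE (Lbracket_hom x0 wk); case: w wk {x0} => y [Q b].
rewrite mem_Lgrade /= => /andP[yk /mem_IPS[_ [QB _ _ _]]].
rewrite zero_lfunE comp_lfun0l comp_lfun0r !linear0 /=.
rewrite !(scaler0, zero_lfunE, subr0, addr0, sub0r) mem_Lgrade /=.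
rewrite memvN memvZ /=; last by rewrite addbC QB.
apply/mem_IPS; split; last exact: companion_btri.
by apply: mem_spanset; exists i, k, x, y.
Qed.

Lemma homLbracketPl (F : fieldType) (V : vectType F) (B : bolSuperalgebra V)
    (i j : bool) (t : F) (u u' v : lieT V) :
  homLbracket B i j (t *: u + u') v
  = t *: homLbracket B i j u v + homLbracket B i j u' v.
Proof.
case: u u' v => [x [P a]] [x' [P' a']] [y [Q b]] /=; congr (_, (_, _)).
- rewrite !(linearP, lfun_simp) /=.
  rewrite !(scalerDr, scalerN, opprD) !scalerA (mulrC t).
  by rewrite addrACA.
- apply/lfunP=> z; rewrite !(linearP, lfun_simp) /=.
  rewrite !(scalerDr, scalerN, opprD) !scalerA (mulrC t).
  by rewrite [RHS]addrACA; congr (_ + _); rewrite addrACA.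
- rewrite !(linearP, lfun_simp) /=.
  rewrite !(scalerDr, scalerN, opprD) !scalerA (mulrC t).
  rewrite [RHS]addrACA; congr (_ + _).
  by rewrite [RHS]addrACA; congr (_ + _); rewrite addrACA.
Qed.

Lemma LadP (F : fieldType) (V : vectType F) (B : bolSuperalgebra V)
    (t : F) (u u' : lieT V) : Lad B (t *: u + u') = t *: Lad B u + Lad B u'.
Proof.
apply/lfunP=> v; rewrite !lfun_simp !LadE /Lbracket scaler_sumr -big_split /=.
apply: eq_bigr => i _; rewrite scaler_sumr -big_split /=.
by apply: eq_bigr => j _; rewrite /Lcomp linearP homLbracketPl.
Qed.

Lemma supertraceP (F : fieldType) (W : vectType F) (G : bool -> {vspace W})
    (t : F) (f g : 'End(W)) :
  supertrace G (t *: f + g) = t * supertrace G f + supertrace G g.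
Proof.
have blockP (U U' : {vspace W}) : block_trace U U' (t *: f + g)
    = t * block_trace U U' f + block_trace U U' g.
  rewrite /block_trace mulr_sumr -big_split; apply: eq_bigr => i _ /=.
  by rewrite !lfun_simp !linearP.
rewrite /supertrace !blockP; ring.
Qed.

Lemma killing_ricciPl (F : fieldType) (V : vectType F) (B : bolSuperalgebra V)
    (t : F) (x x' y : V) :
  killing_ricci B (t *: x + x') y
  = t * killing_ricci B x y + killing_ricci B x' y.
Proof.
rewrite /killing_ricci /killing -supertraceP.
have -> : ((t *: x + x', 0) : lieT V) = t *: (x, 0) + (x', 0).
  by congr (_, _); rewrite /= scaler0 addr0.
by rewrite LadP comp_lfunDl comp_lfunZl.
Qed.

Lemma killing_ricci_supersym (F : fieldType) (V : vectType F)
    (B : bolSuperalgebra V) (i j : bool) (x y : V) :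
    x \in B i -> y \in B j ->
  killing_ricci B x y = (-1) ^+ (i && j) * killing_ricci B y x.
Proof.
move=> xi yj; apply: supertrace_supercomm => [k | k w | k w].
- exact: Lgrade_cap.
- exact: Lad_grade.
- exact: Lad_grade.
Qed.

(** * Symmetries of the form K([x,y,z],u) *)

(** Supersymmetric forms on the superspace G_0 + G_1, linear in the first
    argument. *)
Definition supersymmetric_form (F : fieldType) (V : vectType F)
    (G : bool -> {vspace V}) (K : V -> V -> F) : Prop :=
  (forall t x y u, K (t *: x + y) u = t * K x u + K y u) /\
  (forall i j x y, x \in G i -> y \in G j ->
     K x y = (-1) ^+ (i && j) * K y x).

(** K([x,y,z],u) is skew-supersymmetric in z and u. *)
Definition skew_last (F : fieldType) (V : vectType F) (B : bolSuperalgebra V)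
    (K : V -> V -> F) : Prop :=
  forall i j k l x y z u, x \in B i -> y \in B j -> z \in B k -> u \in B l ->
    K (btri B x y z) u = - ((-1) ^+ (k && l) * K (btri B x y u) z).

(** K([x,y,z],u) is invariant under the reversal of x, y, z, u; the sign is
    that of the reversal of four homogeneous elements, each pair of which is
    exchanged. *)
Definition reversible (F : fieldType) (V : vectType F) (B : bolSuperalgebra V)
    (K : V -> V -> F) : Prop :=
  forall i j k l x y z u, x \in B i -> y \in B j -> z \in B k -> u \in B l ->
    K (btri B x y z) u
    = (-1) ^+ ((i && j) (+) (i && k) (+) (i && l)
               (+) (j && k) (+) (j && l) (+) (k && l)) * K (btri B u z y) x.

Lemma supersymmetric_formD (F : fieldType) (V : vectType F)
    (G : bool -> {vspace V}) (K : V -> V -> F) (x y u : V) :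
  supersymmetric_form G K -> K (x + y) u = K x u + K y u.
Proof. by case=> KP _; rewrite -[x]scale1r KP mul1r scale1r. Qed.

Lemma supersymmetric_formZ (F : fieldType) (V : vectType F)
    (G : bool -> {vspace V}) (K : V -> V -> F) (t : F) (x u : V) :
  supersymmetric_form G K -> K (t *: x) u = t * K x u.
Proof.
case=> KP _; have K0 : K 0 u = 0.
  by have := KP (-1) 0 0 u; rewrite scaler0 addr0 mulN1r addNr.
by rewrite -[_ *: x]addr0 KP K0 addr0.
Qed.

Lemma form_btri_skew (F : fieldType) (V : vectType F) (B : bolSuperalgebra V)
    (K : V -> V -> F) (i j k : bool) (x y z u : V) :
    supersymmetric_form B K -> x \in B i -> y \in B j -> z \in B k ->
  K (btri B x y z) u = - ((-1) ^+ (i && j) * K (btri B y x z) u).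
Proof.
move=> KS xi yj zk; rewrite (bol2 xi yj zk) -scaleNr.
by rewrite (supersymmetric_formZ _ _ _ KS) mulNr.
Qed.

Lemma form_btri_cyclic (F : fieldType) (V : vectType F) (B : bolSuperalgebra V)
    (K : V -> V -> F) (i j k : bool) (x y z u : V) :
    supersymmetric_form B K -> x \in B i -> y \in B j -> z \in B k ->
  K (btri B x y z) u + (-1) ^+ (i && (j (+) k)) * K (btri B y z x) u
    + (-1) ^+ (k && (i (+) j)) * K (btri B z x y) u = 0.
Proof.
move=> KS xi yj zk; rewrite -!(supersymmetric_formZ _ _ _ KS).
rewrite -!(supersymmetric_formD _ _ _ KS) (bol3 xi yj zk).
by rewrite -(scale0r 0) (supersymmetric_formZ _ _ _ KS) mul0r.
Qed.

Lemma form_btri_supersym (F : fieldType) (V : vectType F)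
    (B : bolSuperalgebra V) (K : V -> V -> F) (i j k l : bool) (x y z u : V) :
    supersymmetric_form B K ->
    x \in B i -> y \in B j -> z \in B k -> u \in B l ->
  K u (btri B x y z) = (-1) ^+ (l && (i (+) j (+) k)) * K (btri B x y z) u.
Proof. by move=> [_ KC] xi yj zk ul; apply: KC => //; apply: btri_grade. Qed.

(** Condition (i) says that K([x,y,z],u) is skew in z and u. *)
Lemma skew_lastP (F : fieldType) (V : vectType F) (B : bolSuperalgebra V)
    (K : V -> V -> F) : supersymmetric_form B K ->
  (forall i j k l x y z u, x \in B i -> y \in B j -> z \in B k -> u \in B l ->
    K (btri B x y z) u = - ((-1) ^+ (k && (i (+) j)) * K z (btri B x y u)))
  <-> skew_last B K.
Proof.
move=> KS; split=> H i j k l x y z u xi yj zk ul.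
  by rewrite (H i j k l) // (@form_btri_supersym _ _ _ _ i j l k) //;
    destruct i, j, k, l; rewrite /=; ring.
by rewrite (H i j k l) // (@form_btri_supersym _ _ _ _ i j l k) //;
  destruct i, j, k, l; rewrite /=; ring.
Qed.

(** Condition (ii) says that K([x,y,z],u) is invariant under reversal. *)
Lemma reversible_leftP (F : fieldType) (V : vectType F) (B : bolSuperalgebra V)
    (K : V -> V -> F) : supersymmetric_form B K ->
  (forall i j k l x y z u, x \in B i -> y \in B j -> z \in B k -> u \in B l ->
    K (btri B x y z) u = - ((-1) ^+ (j && (k (+) l)) * K x (btri B z u y)))
  <-> reversible B K.
Proof.
move=> KS; split=> H i j k l x y z u xi yj zk ul; rewrite (H i j k l) //;
  rewrite (@form_btri_supersym _ _ _ _ k l j i) // (form_btri_skew x KS zk ul yj).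
  by destruct i, j, k, l; rewrite /=; ring.
by destruct i, j, k, l; rewrite /=; ring.
Qed.

(** Condition (iii) says that K([y,z,u],x) is invariant under reversal. *)
Lemma reversible_rightP (F : fieldType) (V : vectType F) (B : bolSuperalgebra V)
    (K : V -> V -> F) : supersymmetric_form B K ->
  (forall i j k l x y z u, x \in B i -> y \in B j -> z \in B k -> u \in B l ->
    K x (btri B y z u)
    = (-1) ^+ ((i && j) (+) (k && l)) * K y (btri B x u z))
  <-> reversible B K.
Proof.
move=> KS; split=> H i j k l x y z u xi yj zk ul.
  have := H l i j k u x y z ul xi yj zk.
  rewrite (@form_btri_supersym _ _ _ _ i j k l) //.
  rewrite (@form_btri_supersym _ _ _ _ l k j i) //.
  move=> /(congr1 ( *%R ((-1) ^+ (l && (i (+) j (+) k))))).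
  rewrite mulrA -expr2 sqrr_sign mul1r => ->.
  by destruct i, j, k, l; rewrite /=; ring.
rewrite (@form_btri_supersym _ _ _ _ j k l i) //.
rewrite (@form_btri_supersym _ _ _ _ i l k j) //.
rewrite (H j k l i) //.
by destruct i, j, k, l; rewrite /=; ring.
Qed.

(** A curvature-like form is invariant under the exchange of its first two
    arguments with its last two; as it is skew in both pairs, this is the
    invariance under reversal. *)
Lemma curvature_skew_rev (F : fieldType) (V : vectType F)
    (B : bolSuperalgebra V) (K : V -> V -> F) :
  2%:R != 0 :> F -> supersymmetric_form B K -> skew_last B K -> reversible B K.
Proof.
move=> F2 KS H i j k l x y z u xi yj zk ul.
have skew12 := form_btri_skew _ KS.
have cxyz := form_btri_cyclic u KS xi yj zk.
have cyzu := form_btri_cyclic x KS yj zk ul.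
have czux := form_btri_cyclic y KS zk ul xi.
have cuxy := form_btri_cyclic z KS ul xi yj.
(* Up to the two skew-symmetries, the twelve values in the four identities are
   [x,y,z].u, [y,z,x].u, [z,x,y].u, [z,u,x].y, [x,u,y].z and [y,u,z].x. *)
rewrite (H _ _ _ _ _ _ _ _ yj zk ul xi) (H _ _ _ _ _ _ _ _ zk ul yj xi)
  (skew12 _ _ _ _ _ _ _ ul yj zk) in cyzu.
rewrite (skew12 _ _ _ _ _ _ _ ul xi zk) (H _ _ _ _ _ _ _ _ xi ul zk yj)
  (skew12 _ _ _ _ _ _ _ xi zk ul) (H _ _ _ _ _ _ _ _ zk xi ul yj) in czux.
rewrite (skew12 _ _ _ _ _ _ _ ul xi yj) (H _ _ _ _ _ _ _ _ xi yj ul zk)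
  (H _ _ _ _ _ _ _ _ yj ul xi zk) in cuxy.
rewrite (skew12 _ _ _ _ _ _ _ ul zk yj) (H _ _ _ _ _ _ _ _ zk ul yj xi).
(* Each cyclic identity is weighted by the sign of its cyclic permutation of
   x, y, z, u, with a further minus sign for the last two. *)
apply/eqP; rewrite -subr_eq0; apply/eqP/(mulfI F2); rewrite mulr0.
have combine (a b c d p q r : F) : a = 0 -> b = 0 -> c = 0 -> d = 0 ->
    a + p * b - q * c - r * d = 0.
  by move=> -> -> -> ->; ring.
apply: etrans (combine _ _ _ _ ((-1) ^+ (i && (j (+) k (+) l)))
  ((-1) ^+ ((i (+) j) && (k (+) l))) ((-1) ^+ (l && (i (+) j (+) k)))
  cxyz cyzu czux cuxy).
by destruct i, j, k, l; rewrite /=; ring.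
Qed.

(** Reversing, exchanging the first two arguments and reversing again exchanges
    the last two arguments. *)
Lemma reversible_skew_last (F : fieldType) (V : vectType F)
    (B : bolSuperalgebra V) (K : V -> V -> F) :
  supersymmetric_form B K -> reversible B K -> skew_last B K.
Proof.
move=> KS H i j k l x y z u xi yj zk ul.
rewrite (H i j k l) // (form_btri_skew x KS ul zk yj) (H k l j i) //.
by rewrite (form_btri_skew z KS xi yj ul);
  destruct i, j, k, l; rewrite /=; ring.
Qed.

Lemma killing_ricci_form (F : fieldType) (V : vectType F)
  (B : bolSuperalgebra V) : supersymmetric_form B (killing_ricci B).
Proof.
split=> [t x y u | i j x y]; first exact: killing_ricciPl.
exact: killing_ricci_supersym.
Qed.

Theorem lemma4p6 (F : fieldType) (charF : [pchar F] =i pred0)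
    (V : vectType F) (B : bolSuperalgebra V) :
  let K := killing_ricci B in
  let cond_i := forall i j k l x y z u,
    x \in B i -> y \in B j -> z \in B k -> u \in B l ->
    K (btri B x y z) u
      = - ((-1) ^+ (k && (i (+) j)) * K z (btri B x y u)) in
  let cond_ii := forall i j k l x y z u,
    x \in B i -> y \in B j -> z \in B k -> u \in B l ->
    K (btri B x y z) u
      = - ((-1) ^+ (j && (k (+) l)) * K x (btri B z u y)) in
  let cond_iii := forall i j k l x y z u,
    x \in B i -> y \in B j -> z \in B k -> u \in B l ->
    K x (btri B y z u)
      = (-1) ^+ ((i && j) (+) (k && l)) * K y (btri B x u z) in
  (cond_i <-> cond_ii) /\ (cond_ii <-> cond_iii).
Proof.
move=> K cond_i cond_ii cond_iii; have KS := killing_ricci_form B.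
have iP : cond_i <-> skew_last B K := skew_lastP KS.
have iiP : cond_ii <-> reversible B K := reversible_leftP KS.
have iiiP : cond_iii <-> reversible B K := reversible_rightP KS.
have F2 : 2%:R != 0 :> F by rewrite ((pcharf0P F).1 charF).
have fwd := curvature_skew_rev F2 KS; have bwd := reversible_skew_last KS.
by tauto.
Qed.
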